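(* Assume that the following conditions are satisfied: (a) $a\in\mathbb{R}^{\ell}$, $F\subseteq\mathbb{R}^{\ell}$ is a nonempty closed set. (b) $H$ is a proper closed subset of $\mathbb{R}^{\ell}$ with $k\in 0^+H\setminus\{0\}$. (c) There exist a polyhedral cone $C\subset\mathbb{R}^{\ell}$, some $z\in\operatorname{cl}\operatorname{conv}H$ and $u\in\mathbb{R}^{\ell}$ such that $$z-\operatorname{cl}\operatorname{conv}H\subset\operatorname{int}C\cup\{0\}\quad\text{and}\quad (F-u)\cap\operatorname{int}C=\emptyset.$$ (d) The problem $(P_{F,a,H,k})$ has a feasible solution. (e) One of the following assumptions is fulfilled: (i) $F\cap(a-H)=\emptyset$, (ii) $F\cap(a-\operatorname{int}H)=\emptyset$ and $H+\mathbb{R}_{>}k\subset\operatorname{int}H$, (iii) $H$ does not contain a line in direction $k$. Then $M_{F,a,H,k}$ is nonempty and compact.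
   Context: $\ell\ge 1$ is an integer and $\mathbb{R}_>=(0,\infty)$. For $A\subseteq\mathbb{R}^{\ell}$, the recession cone is $0^+A:=\{u\in\mathbb{R}^{\ell}\mid A+\mathbb{R}_+u\subseteq A\}$, where $\mathbb{R}_+=[0,\infty)$; $\operatorname{int}$, $\operatorname{cl}$, $\operatorname{conv}$ denote topological interior, closure and convex hull. A proper subset of $\mathbb{R}^{\ell}$ is a nonempty subset different from $\mathbb{R}^{\ell}$. A polyhedral cone is a set of the form $\{x\in\mathbb{R}^{\ell}\mid Bx\le 0\}$ for some real matrix $B$. $H$ contains a line in direction $k$ if $x+\mathbb{R}k\subseteq H$ for some $x$. $(P_{F,a,H,k})$ is the problem of minimizing $t$ over all pairs $(y,t)\in F\times\mathbb{R}$ with $y\in a-H+tk$ (the feasible solutions). $M_{F,a,H,k}$ is the set of its optimal solutions $y$, i.e. of all $y\in F$ for which there is $t\in\mathbb{R}$ such that $(y,t)$ is feasible and $t\le s$ for every feasible $(z,s)$. *)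

(* Defs.v *)
From mathcomp Require Import all_boot all_order all_algebra.
From mathcomp Require Import all_classical all_reals all_analysis.

Set Implicit Arguments.
Unset Strict Implicit.
Unset Printing Implicit Defensive.

Import Order.TTheory GRing.Theory Num.Theory.
Import numFieldNormedType.Exports.

Local Open Scope classical_set_scope.
Local Open Scope ring_scope.

Section Defs.
Context {R : realType} {l : nat}.
Implicit Types (A F H C : set 'rV[R]_l) (a k u x y : 'rV[R]_l) (t : R).

Definition convex_hull A : set 'rV[R]_l := smallest (@convex_set R 'rV[R]_l) A.

Definition recession_cone A : set 'rV[R]_l :=
  [set u | [set x + t *: u | x in A & t in [set t : R | 0 <= t]] `<=` A].

Definition proper_subset A : Prop := A !=set0 /\ A <> setT.

(* Points are row vectors, hence the transpose. *)
Definition polyhedral_cone C : Prop :=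
  exists (m : nat) (B : 'M[R]_(m, l)),
    C = [set x | forall i, (B *m x^T) i ord0 <= 0].

Definition contains_line H k : Prop :=
  exists x, [set x + t *: k | t in [set: R]] `<=` H.

Definition feasible F a H k : set ('rV[R]_l * R) :=
  [set yt | F yt.1 /\ [set a - h + yt.2 *: k | h in H] yt.1].

Definition optimal_solutions F a H k : set 'rV[R]_l :=
  [set y | F y /\ exists t, feasible F a H k (y, t) /\
    forall z s, feasible F a H k (z, s) -> t <= s].

End Defs.

(* Main.v *)
Require Import Defs.
From mathcomp Require Import all_boot all_order all_algebra.
From mathcomp Require Import all_classical all_reals all_analysis.

Set Implicit Arguments.
Unset Strict Implicit.
Unset Printing Implicit Defensive.

Import Order.TTheory GRing.Theory Num.Theory.
Import numFieldNormedType.Exports.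

Local Open Scope classical_set_scope.
Local Open Scope ring_scope.

(* The sets S(s) = F `&` (a - H + s k) increase with s, and they are compact:
   writing cl conv H = D, the set z - D is star-shaped at 0 and, away from 0,
   lies in the open cone int C, so only a bounded part of any translate of it can
   avoid int C. Hence some y lies in every nonempty S(s), and the s with S(s)
   nonempty are exactly those with a + s k - y in H, a closed set of reals. By (e)
   this set is bounded below, so it has a minimum t, and M = S(t). *)

Lemma closed_preimage_subl (R : realType) (V : normedModType R) (A : set V) v :
  closed A -> closed [set y | A (v - y)].
Proof.
move=> clA; apply: (@preimage_closed _ _ (fun y => v - y)) => // y _.
by apply: cvgB; [exact: cvg_cst|exact: cvg_id].
Qed.

(** A convex combination depends continuously on its two endpoints, so approximating both from [A]
    approximates the combination from [A]. *)
Lemma closure_convex (R : realType) (V : normedModType R) (A : set V) :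
  convex_set A -> convex_set (closure A).
Proof.
move=> cA x y t; rewrite !inE => clx cly B.
pose f (p : V * V) := t%:num *: p.1 + (1 - t%:num) *: p.2.
have f_cont : {for (x, y), continuous f}.
  by apply: cvgD; apply: cvgZr => //; [exact: cvg_fst|exact: cvg_snd].
move=> /f_cont[[P Q] /= [/clx[x' [Ax' Px']] /cly[y' [Ay' Qy']]] PQB].
exists (f (x', y')); split; last exact: (PQB (x', y')).
by rewrite -inE; apply: cA; rewrite inE.
Qed.

Lemma convex_hull_convex (R : realType) (l : nat) (A : set 'rV[R]_l) :
  convex_set (convex_hull A).
Proof.
move=> x y t; rewrite !inE => hx hy B cAB.
by rewrite -inE; apply: cAB.1; rewrite inE; [exact: hx|exact: hy].
Qed.

(** The cone is stable under positive scaling, and [t^-1 *: y] is close to [x] when [y] is close to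
    [t *: x]. *)
Lemma interior_polyhedral_coneZ (R : realType) (l : nat) (C : set 'rV[R]_l)
    (t : R) x :
  polyhedral_cone C -> 0 < t -> interior C x -> interior C (t *: x).
Proof.
move=> [m [B ->]] t0 Cx.
have : (fun y : 'rV[R]_l => t^-1 *: y) @ (t *: x) --> x.
  rewrite -[X in _ --> X](scalerK (lt0r_neq0 t0)).
  exact: scaler_continuous.
move=> t1_cvg; apply: (@filterS _ (nbhs (t *: x)) _ _ _ _ (t1_cvg _ Cx)).
move=> y /= By i.
have := By i; rewrite linearZ -scalemxAr mxE.
by rewrite pmulr_rle0// invr_gt0.
Qed.

(* A point c of D of norm at least 1 has c / |c| in the compact intersection of
   D with the unit sphere, which is at positive distance from the complement
   of U; so (c + w) / |c| is in U as soon as |w| / |c| is small. *)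
Lemma bounded_outside_cone (R : realType) (l : nat) (D U : set 'rV[R]_l) w :
  closed D -> (forall c t, D c -> 0 <= t <= 1 -> D (t *: c)) ->
  open U -> (forall c t, U c -> 0 < t -> U (t *: c)) ->
  D `<=` U `|` [set 0] ->
  exists M, forall c, D c -> ~ U (c + w) -> `|c| <= M.
Proof.
move=> clD starD oU coneU DU.
pose K := D `&` [set c | `|c| = 1].
have cptK : compact K.
  apply: bounded_closed_compact.
    by exists 1; split => // M M1 c [_ /= ->]; exact: ltW.
  apply: closedI => //.
  apply: (@preimage_closed _ _ (fun c : 'rV[R]_l => `|c|) [set 1]).
    by move=> c _; exact: norm_continuous.
  exact: closed_eq.
(* Openness of [U] gives a radius near each point of [K]; the near-covering form of compactness
   makes one radius [e] serve all of [K]. *)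
have /nbhs_ballP[e /= e0 He] :
    \forall v \near (0 : 'rV[R]_l), forall c, K c -> U (c + v).
  have nearK : near_covering K by exact/compact_near_coveringP.
  apply: (nearK _ (nbhs (0 : 'rV[R]_l)) (fun v c => U (c + v)) _) => c [Dc /= c1].
  have Uc : U (c + 0).
    rewrite addr0; case: (DU _ Dc) => // c0.
    by move: c1; rewrite c0 normr0 => /esym/eqP; rewrite oner_eq0.
  have := @add_continuous 'rV[R]_l (c, 0).
  by apply; exact: open_nbhs_nbhs.
exists (Num.max 1 (`|w| / e)) => c Dc Ucw.
rewrite leNgt; apply/negP; rewrite gt_max => /andP[c1 cw].
have c0 : 0 < `|c| by exact: lt_trans c1.
apply: Ucw; rewrite -[_ + _]scale1r -(mulfV (lt0r_neq0 c0)) -scalerA.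
apply: coneU => //; rewrite scalerDr; apply: He; last first.
  split; last by rewrite /= normrZ normfV normr_id mulVf ?gt_eqF.
  by apply: starD => //; rewrite invr_ge0 ltW//= invf_le1 ?ltW.
rewrite -ball_normE /= sub0r normrN normrZ normfV normr_id.
by rewrite mulrC ltr_pdivrMr// mulrC -ltr_pdivrMr.
Qed.

(** By monotonicity the nonempty [S s] form a filter base. It has a cluster point in the compact
    [S s0], and closedness puts that point in each nonempty [S s]. *)
Lemma nested_compact (R : realType) (T : topologicalType) (S : R -> set T) s0 :
  (forall s, compact (S s)) -> (forall s, closed (S s)) ->
  {homo S : s t / s <= t >-> s `<=` t} -> S s0 !=set0 ->
  exists y, forall s, S s !=set0 -> S s y.
Proof.
move=> cptS clS ndS S0.
have FF : ProperFilter (filter_from [set s | S s !=set0] S).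
  apply: filter_from_proper => //; apply: filter_from_filter; first by exists s0.
  move=> s t Ss St; exists (Num.min s t).
    by rewrite /= minElt; case: ifP.
  by move=> y Sy; split; apply: ndS Sy; rewrite ge_min lexx ?orbT.
have [|y [_ Fy]] := cptS s0 _ FF; first by exists s0.
exists y => s Ss; apply: clS => B /(Fy (S s)); apply.
by exists s.
Qed.

Lemma closed_infP (R : realType) (A : set R) :
  closed A -> A !=set0 -> has_lbound A -> A (inf A).
Proof.
move=> clA A0 lbA; apply: clA => B /nbhs_ballP[e /= e0 eB].
have [|t At tlt] := @inf_adherent _ A e e0; first by split.
exists t; split => //; apply: eB; rewrite -ball_normE /= distrC ger0_norm.
  by rewrite ltrBlDl.
by rewrite subr_ge0; exact: ge_inf.
Qed.

(** Used with [v = a + s *: k]. For [y] in the set, [c = z - (v - y)] lies in [z - D] and its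
    translate [c + (v - u - z) = y - u] avoids the interior of [C]; this bounds [c], hence [y]. *)
Lemma level_set_compact (R : realType) (l : nat) (F H C : set 'rV[R]_l) z u v :
  closed F -> closed H -> polyhedral_cone C -> closure (convex_hull H) z ->
  [set z - h | h in closure (convex_hull H)] `<=` interior C `|` [set 0] ->
  [set y - u | y in F] `&` interior C = set0 ->
  compact (F `&` [set y | H (v - y)]).
Proof.
move=> clF clH polC Dz DC FC.
pose D := closure (convex_hull H).
have HD : H `<=` D.
  by apply: subset_trans (@subset_closure _ _); exact: sub_gen_smallest.
pose E := [set c | D (z - c)].
have [] := @bounded_outside_cone R l E (interior C) (v - u - z).
- by apply: closed_preimage_subl; exact: closed_closure.
- move=> c t Dc /andP[t0 t1]; rewrite /E /=.
  (* Since [z] itself is in the convex set [D], the segment from [z] to [z - c] stays in [D]; this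
     makes [E] star-shaped at 0. *)
  have -> : z - t *: c = t *: (z - c) + (1 - t) *: z.
    by rewrite scalerBr scalerBl scale1r [RHS]addrC addrA subrK.
  have := @closure_convex R _ _ (@convex_hull_convex R l H) (z - c) z
    (Itv01 t0 t1).
  by rewrite !inE; apply.
- exact: open_interior.
- by move=> c t Cc t0; exact: interior_polyhedral_coneZ.
- by move=> c Dc; apply: DC; exists (z - c) => //; rewrite subKr.
move=> M EM; apply: bounded_closed_compact; last first.
  by apply: closedI => //; exact: closed_preimage_subl.
exists (M + `|v - z|); split; first exact: num_real.
move=> N ltN y [Fy /= Hy].
apply: le_trans (ltW ltN).
have -> : y = (z - (v - y)) + (v - z).
  by rewrite opprB addrC addrA subrK addrC subrK.
apply: le_trans (ler_normD _ _) _; rewrite lerD2r.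
apply: EM; first by rewrite /E /= subKr; exact: HD.
have -> : z - (v - y) + (v - u - z) = y - u.
  by rewrite opprB addrC addrA subrK addrC addrA subrK.
by move=> Cy; rewrite -[False]/(set0 (y - u)) -FC; split => //; exists y.
Qed.

Theorem proposition9 (R : realType) (l : nat) (hl : (1 <= l)%N)
    (a : 'rV[R]_l) (F : set 'rV[R]_l) (F_neq0 : F !=set0) (F_closed : closed F)
    (H : set 'rV[R]_l) (k : 'rV[R]_l)
    (H_proper : proper_subset H) (H_closed : closed H)
    (hk : (recession_cone H `\` [set 0]) k)
    (hC : exists (C : set 'rV[R]_l) (z u : 'rV[R]_l),
        [/\ polyhedral_cone C,
            closure (convex_hull H) z,
            [set z - h | h in closure (convex_hull H)]
              `<=` interior C `|` [set 0] &
            [set y - u | y in F] `&` interior C = set0])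
    (hfeas : feasible F a H k !=set0)
    (he : [\/ F `&` [set a - h | h in H] = set0,
              F `&` [set a - h | h in interior H] = set0 /\
              [set h + t *: k | h in H & t in [set t : R | 0 < t]]
                `<=` interior H
            | ~ contains_line H k]) :
  optimal_solutions F a H k !=set0 /\ compact (optimal_solutions F a H k).
Proof.
case: hC => C [z [u [polC Dz DC FC]]].
have kH h t : H h -> 0 <= t -> H (h + t *: k).
  by move=> Hh t0; apply: hk.1; exists h => //; exists t.
pose S s := F `&` [set y | H (a + s *: k - y)].
have feasE y s : feasible F a H k (y, s) <-> S s y.
  split=> -[/= Fy].
    move=> [h Hh yE]; split => //=.
    by rewrite -yE opprD addrACA subrr addr0 subKr.
  move=> Hy; split => //=; exists (a + s *: k - y) => //.
  by rewrite opprB addrAC addrC subrK.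
have cptS s : compact (S s) by exact: level_set_compact polC Dz DC FC.
have clS s : closed (S s) by apply: compact_closed => //; exact: norm_hausdorff.
have ndS : {homo S : s t / s <= t >-> s `<=` t}.
  move=> s t st y [Fy /= Hy]; split => //=.
  have -> : a + t *: k - y = a + s *: k - y + (t - s) *: k.
    by rewrite [RHS]addrAC scalerBl [in RHS]addrACA subrr addr0.
  by apply: kH => //; rewrite subr_ge0.
have [[y0 s0] /feasE Sy0] := hfeas.
have S0 : S s0 !=set0 by exists y0.
have [y Sy] := nested_compact cptS clS ndS S0.
have Fy : F y by case: (Sy _ S0).
pose T := [set s | S s !=set0].
(* The single point [y] tests nonemptiness of every [S s], so [T] is the preimage of [H] under a
   continuous map. *)
have TE : T = [set s | H (a + s *: k - y)].
  by apply/seteqP; split => s /= => [/Sy[]//|Hs]; exists y.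
have clT : closed T.
  rewrite TE; apply: (@preimage_closed _ _ (fun s : R => a + s *: k - y) H) => //.
  move=> s _; apply: cvgB; last exact: cvg_cst.
  by apply: cvgD; [exact: cvg_cst|apply: cvgZl; exact: cvg_id].
have lbT : has_lbound T.
  apply: contrapT => nlbT.
  (* Some [t < s] has [S t] nonempty, and monotonicity carries [y] from [S t] to [S s]: the whole
     line through [a - y] in direction [k] lies in [H]. *)
  have Hy s : H (a + s *: k - y).
    have [t Tt ts] : exists2 t, T t & t < s.
      apply: contrapT => nt; apply: nlbT; exists s => t Tt.
      by rewrite leNgt; apply/negP => ts; apply: nt; exists t.
    by have [] := ndS _ _ (ltW ts) _ (Sy _ Tt).
  (* [B] will be [H] in the first case of [he] and its interior in the second. *)
  have yH B : B (a - y) -> (F `&` [set a - h | h in B]) y.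
    by move=> By; split => //; exists (a - y) => //; rewrite subKr.
  case: he => [FH0|[FH0 Hint]|]; last 1 first.
  - apply; exists (a - y) => _ [t _ <-]; rewrite addrAC; exact: Hy.
  - suff: (set0 : set 'rV[R]_l) y by [].
    by rewrite -FH0; apply: yH; have := Hy 0; rewrite scale0r addr0.
  - suff: (set0 : set 'rV[R]_l) y by [].
    rewrite -FH0; apply: yH; apply: Hint.
    (* The line point at parameter -1 is in [H]; moving it by [1 *: k] puts [a - y] in the interior
       of [H]. *)
    exists (a + (-1) *: k - y) => //; exists 1 => //=.
    by rewrite scaleN1r scale1r addrAC subrK.
have Tinf : T (inf T) by apply: closed_infP => //; exists s0.
have -> : optimal_solutions F a H k = S (inf T).
  apply/seteqP; split => x; last first.
    move=> Sx; split; first by case: Sx.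
    exists (inf T); split; first exact/feasE.
    by move=> x' s /feasE Sx'; apply: ge_inf => //; exists x'.
  (* The value [inf T] is attained by a feasible pair, so an optimal [t] is at most [inf T], and
     monotonicity applies. *)
  move=> [Fx [t [/feasE Sx tmin]]].
  apply: ndS Sx; have [x' /feasE] := Tinf; exact: tmin.
by split.
Qed.
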